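(* Let $L\subset\mathbb{Z}^n$ be a non-positive lattice and $F$ an $I_L$-fiber. The cardinality of the equivalence class $\overline F$ is equal to $|\mathbb{Z}^s/(L_{pure})_\sigma|$, where $s=|\sigma|$.
   Context: Let $\mathbb{N}=\mathbb{Z}_{\ge0}$. A lattice is a subgroup $L\subset\mathbb{Z}^n$; it is non-positive if $L\cap\mathbb{N}^n\neq\{\mathbf 0\}$. $L^+=L\cap\mathbb{N}^n$; $L_{pure}$ is the subgroup of $L$ generated by $L^+$; $\sigma=\bigcup_{w\in L^+}\operatorname{supp}(w)$, where $\operatorname{supp}(w)=\{i:w_i\ne0\}$. For $u\in\mathbb{Z}^n$, $u_\sigma=(u_i)_{i\in\sigma}\in\mathbb{Z}^s$, and $(L_{pure})_\sigma\subset\mathbb{Z}^s$ is the lattice generated by the vectors $u_\sigma$, $u\in L_{pure}$. An $I_L$-fiber is a set of monomials in $x_1,\ldots,x_n$ of the form $F_u=\{x^v:v\in\mathbb{N}^n,\ v-u\in L\}$ with $u\in\mathbb{N}^n$. Fibers $F,G$ are equivalent if there are $u,v\in\mathbb{N}^n$ with $x^uF\subset G$ and $x^vG\subset F$; $\overline F$ denotes the equivalence class of $F$ (a set of fibers). *)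

(* Defs.v *)
From HB Require Import structures.
From mathcomp Require Import all_boot all_order all_algebra.
From mathcomp Require Import mpoly.
From mathcomp Require Import boolp classical_sets functions cardinality.

Set Implicit Arguments.
Unset Strict Implicit.
Unset Printing Implicit Defensive.

Import Order.TTheory GRing.Theory Num.Theory.

Local Open Scope classical_set_scope.
Local Open Scope ring_scope.

(* A lattice in Z^n is an instance of [zmodClosed 'rV[int]_n].  Its membership
   predicate is boolean, which is no restriction classically: the generated
   lattice below is a [zmodClosed] defined from an arbitrary [set]. *)
Definition lattice_gen (m : nat) (A : set 'rV[int]_m) : {pred 'rV[int]_m} :=
  [pred v | v \in smallest (fun H : set 'rV[int]_m => zmod_closed (mem H)) A].

Lemma lattice_gen_zmod_closed (m : nat) (A : set 'rV[int]_m) :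
  zmod_closed (lattice_gen A).
Proof.
split=> [|u v]; rewrite !inE.
  by move=> H [[H0 _] _]; rewrite inE in H0.
move=> Au Av H [[H0 HB] AH]; have := HB u v; rewrite !inE; apply.
- exact: Au.
- exact: Av.
Qed.

HB.instance Definition _ (m : nat) (A : set 'rV[int]_m) :=
  GRing.isZmodClosed.Build 'rV[int]_m (lattice_gen A)
    (lattice_gen_zmod_closed A).

Definition lattice_pos (n : nat) (L : zmodClosed 'rV[int]_n) :
    set 'rV[int]_n :=
  [set w | w \in L /\ forall i, 0 <= w 0 i].

Definition non_positive (n : nat) (L : zmodClosed 'rV[int]_n) : Prop :=
  lattice_pos L <> [set 0].

Definition lattice_pure (n : nat) (L : zmodClosed 'rV[int]_n) :
    zmodClosed 'rV[int]_n :=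
  lattice_gen (lattice_pos L).

Definition supp (n : nat) (w : 'rV[int]_n) : {set 'I_n} :=
  [set i | w 0 i != 0]%SET.

Definition sigma (n : nat) (L : zmodClosed 'rV[int]_n) : {set 'I_n} :=
  [set i | `[< exists2 w, lattice_pos L w & i \in supp w >]]%SET.

(* The coordinates indexed by S, listed in increasing order. *)
Definition restr (n : nat) (S : {set 'I_n}) (u : 'rV[int]_n) :
    'rV[int]_#|S| :=
  \row_j u 0 (enum_val j).

Definition lattice_pure_sigma (n : nat) (L : zmodClosed 'rV[int]_n) :
    zmodClosed 'rV[int]_#|sigma L| :=
  lattice_gen [set restr (sigma L) u | u in [set u | u \in lattice_pure L]].

(* ['X_{1..n}] is the type of monomials x^v, written additively: the product
   x^u x^v is [(u + v)%MM]. *)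
Definition mnm_row (n : nat) (v : 'X_{1..n}) : 'rV[int]_n :=
  \row_i (v i)%:Z.

Definition fiber (n : nat) (L : zmodClosed 'rV[int]_n) (u : 'X_{1..n}) :
    set 'X_{1..n} :=
  [set v | mnm_row v - mnm_row u \in L].

Definition is_fiber (n : nat) (L : zmodClosed 'rV[int]_n)
    (F : set 'X_{1..n}) : Prop :=
  exists u, F = fiber L u.

Definition mnm_shift (n : nat) (u : 'X_{1..n}) (F : set 'X_{1..n}) :
    set 'X_{1..n} :=
  [set (u + v)%MM | v in F].

Definition fiber_equiv (n : nat) (F G : set 'X_{1..n}) : Prop :=
  exists u v, mnm_shift u F `<=` G /\ mnm_shift v G `<=` F.

Definition fiber_class (n : nat) (L : zmodClosed 'rV[int]_n)
    (F : set 'X_{1..n}) : set (set 'X_{1..n}) :=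
  [set G | is_fiber L G /\ fiber_equiv F G].

(* Main.v *)
Require Import Defs.
From mathcomp Require Import all_boot all_order all_algebra.
From mathcomp Require Import mpoly ring.
From mathcomp Require Import boolp classical_sets functions cardinality.

Set Implicit Arguments.
Unset Strict Implicit.
Unset Printing Implicit Defensive.

Import Order.TTheory GRing.Theory Num.Theory.

Local Open Scope classical_set_scope.
Local Open Scope card_scope.
Local Open Scope ring_scope.

(** Fix a base point [u] of the fiber [F] and write s for [#|sigma L|].
    If x^a F_u and x^b F_v lie in F_v and F_u respectively, then [a + b] is a
    non-negative vector of [L], so [a] and [b] are supported in [sigma L]:
    equivalent fibers differ by a translation along the coordinates in
    [sigma L] ([fiber_equivP]).  Conversely every such translation yields an
    equivalent fiber.  The point is that the sum of enough vectors of L^+ is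
    some [w] that is positive on all of [sigma L], and adding a large multiple
    of [w], which does not change classes modulo [L], makes any vector
    supported in [sigma L] non-negative ([lattice_pos_translate]).

    Hence Z^s acts transitively on the class of [F] by translations: [z] sends
    [F_u] to the fiber of monomials congruent to [u + extend z] modulo [L],
    [extend] being extension by zero.  Two translations give the same fiber
    exactly when their difference extends to an element of [L].  The same
    vector [w] shows that the vectors of [L] supported in [sigma L] are
    precisely those of the pure part of [L] ([mem_lattice_pure]): such a vector
    is [(y + k w) - k w] with both terms in L^+.  So the stabilizer is the
    restriction of the pure part to [sigma L] ([mem_lattice_pure_sigma]), and
    the class is in bijection with the quotient. *)

(** * Generated lattices *)

Lemma mem_lattice_gen (m : nat) (A : set 'rV[int]_m) (v : 'rV[int]_m) :
  A v -> v \in lattice_gen A.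
Proof. by move=> Av; rewrite !inE; apply: sub_gen_smallest. Qed.

Lemma lattice_gen_sub (m : nat) (A : set 'rV[int]_m)
    (M : set 'rV[int]_m) :
  (M 0 /\ forall x y, M x -> M y -> M (x - y)) -> A `<=` M ->
  forall v, v \in lattice_gen A -> M v.
Proof.
move=> [M0 MB] AM v; rewrite !inE; apply; split=> //.
by split=> [|x y]; rewrite !inE //; apply: MB.
Qed.

(** * Vectors supported in a set of coordinates *)

Definition supported (n : nat) (S : {set 'I_n}) (y : 'rV[int]_n) : Prop :=
  forall i, i \notin S -> y 0 i = 0.

(** Extension by zero: the sum has one term when [i] is in [S], none
    otherwise. *)
Definition extend (n : nat) (S : {set 'I_n}) (z : 'rV[int]_#|S|) :
    'rV[int]_n :=
  \row_i \sum_(j | enum_val j == i) z 0 j.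

Lemma extendB (n : nat) (S : {set 'I_n}) (z z' : 'rV[int]_#|S|) :
  extend (z - z') = extend z - extend z'.
Proof.
apply/rowP=> i; rewrite !mxE -sumrB.
by apply: eq_bigr => j _; rewrite !mxE.
Qed.

Lemma supported_extend (n : nat) (S : {set 'I_n}) (z : 'rV[int]_#|S|) :
  supported S (extend z).
Proof.
move=> i iS; rewrite mxE big1 // => j /eqP ji.
by case/negP: iS; rewrite -ji enum_valP.
Qed.

Lemma extendK (n : nat) (S : {set 'I_n}) : cancel (@extend n S) (restr S).
Proof.
move=> z; apply/rowP=> j; rewrite !mxE (bigD1 j) //= big1 ?addr0 // => k.
by case/andP=> /eqP/enum_val_inj ->; rewrite eqxx.
Qed.

Lemma restrK (n : nat) (S : {set 'I_n}) (y : 'rV[int]_n) :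
  supported S y -> extend (restr S y) = y.
Proof.
move=> yS; apply/rowP=> i.
have [iS|iS] := boolP (i \in S); last by rewrite supported_extend ?yS.
rewrite mxE (bigD1 (enum_rank_in iS i)) /=; last by rewrite enum_rankK_in.
rewrite mxE enum_rankK_in // big1 ?addr0 // => k /andP[/eqP ki].
by rewrite -(enum_valK_in iS k) ki eqxx.
Qed.

(** * Non-negative vectors of a lattice *)

Lemma lattice_pos_supported (n : nat) (L : zmodClosed 'rV[int]_n)
    (w : 'rV[int]_n) :
  lattice_pos L w -> supported (sigma L) w.
Proof.
move=> Lw i; rewrite inE => iS; apply/eqP/negPn/negP => wi.
by case/negP: iS; apply/asboolP; exists w => //; rewrite inE.
Qed.

(** Each coordinate in [sigma L] is positive on some vector of L^+; summing one
    such vector per coordinate makes them all positive at once. *)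
Lemma lattice_pos_full_support (n : nat) (L : zmodClosed 'rV[int]_n) :
  exists2 w, lattice_pos L w & forall i, i \in sigma L -> 0 < w 0 i.
Proof.
have pick_pos i : exists w, lattice_pos L w /\ (i \in sigma L -> 0 < w 0 i).
  have [|iS] := boolP (i \in sigma L).
    rewrite inE => /asboolP[w Lw wi]; exists w; split=> // _.
    by rewrite lt0r; case: Lw => _ ->; rewrite inE in wi; rewrite wi.
  exists 0; split=> //; split; first exact: rpred0.
  by move=> j; rewrite mxE.
have [w wP] := choice pick_pos.
exists (\sum_i w i).
  split; first by apply: rpred_sum => i _; case: (wP i) => -[].
  move=> j; rewrite summxE; apply: sumr_ge0 => i _.
  by case: (wP i) => -[].
move=> i iS; rewrite summxE (bigD1 i) //=.
apply: ltr_wpDr; last by case: (wP i) => _; apply.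
by apply: sumr_ge0 => j _; case: (wP j) => -[].
Qed.

(** Take a vector of L^+ that is at least 1 on [sigma L] and multiply it by a
    bound for the entries of [y]. *)
Lemma lattice_pos_translate (n : nat) (L : zmodClosed 'rV[int]_n)
    (y : 'rV[int]_n) :
  supported (sigma L) y ->
  exists2 w, lattice_pos L w & forall i, 0 <= y 0 i + w 0 i.
Proof.
move=> yS; have [w [Lw w_ge0] w_gt0] := lattice_pos_full_support L.
pose k := (\sum_i absz (y 0%R i))%N.
exists (w *+ k).
  split; first exact: rpredMn.
  by move=> i; rewrite mulmxnE mulrn_wge0.
move=> i; rewrite mulmxnE.
have [iS|iS] := boolP (i \in sigma L); last first.
  by rewrite yS // add0r mulrn_wge0.
have yk : `|y 0 i| <= k%:Z.
  by rewrite -abszE lez_nat /k (bigD1 i) //= leq_addr.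
have wk : k%:Z <= w 0 i *+ k.
  by rewrite -[k%:Z]natz lerMn2r -gtz0_ge1 w_gt0 ?orbT.
rewrite -lerBlDl sub0r; apply: le_trans wk; apply: le_trans yk.
by rewrite -normrN ler_norm.
Qed.

(** A vector of [L] supported in [sigma L] is the difference of its translate
    into L^+ and the translating vector of L^+. *)
Lemma mem_lattice_pure (n : nat) (L : zmodClosed 'rV[int]_n)
    (y : 'rV[int]_n) :
  y \in lattice_pure L <-> y \in L /\ supported (sigma L) y.
Proof.
split.
  pose M : set 'rV[int]_n := [set v | v \in L /\ supported (sigma L) v].
  apply: (@lattice_gen_sub _ _ M) => [|w Lw].
    split; first by split=> [|i _]; rewrite ?rpred0 ?mxE.
    move=> x x' [Lx Sx] [Lx' Sx']; split=> [|i iS]; first exact: rpredB.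
    by rewrite !mxE Sx // Sx' // subr0.
  by split; [case: Lw | apply: lattice_pos_supported].
move=> [Ly yS]; have [w Lw yw_ge0] := lattice_pos_translate yS.
rewrite -[y](addrK w); apply: rpredB; apply: mem_lattice_gen => //.
split; first by apply: rpredD => //; case: Lw.
by move=> i; rewrite mxE.
Qed.

Lemma mem_lattice_pure_sigma (n : nat) (L : zmodClosed 'rV[int]_n)
    (z : 'rV[int]_#|sigma L|) :
  z \in lattice_pure_sigma L <-> extend z \in L.
Proof.
split=> [|Lz].
  pose M : set 'rV[int]_#|sigma L| := [set z | extend z \in L].
  apply: (@lattice_gen_sub _ _ M) => [|_ [y /mem_lattice_pure[Ly yS] <-]].
    split; last by move=> x x'; rewrite /M /= extendB; apply: rpredB.
    by rewrite /M /= -(subrr 0) extendB subrr rpred0.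
  by rewrite /M /= restrK.
apply: mem_lattice_gen; exists (extend z); last exact: extendK.
by apply/mem_lattice_pure; split=> //; apply: supported_extend.
Qed.

(** * Fibers and their translates *)

Lemma mnm_rowD (n : nat) (u v : 'X_{1..n}) :
  mnm_row (u + v)%MM = mnm_row u + mnm_row v.
Proof. by apply/rowP=> i; rewrite !mxE mnmDE PoszD. Qed.

Lemma mnm_row_onto (n : nat) (y : 'rV[int]_n) :
  (forall i, 0 <= y 0 i) -> exists u : 'X_{1..n}, mnm_row u = y.
Proof.
move=> y_ge0; exists [multinom absz (y 0%R i) | i < n].
by apply/rowP=> i; rewrite mxE mnmE gez0_abs.
Qed.

Lemma fiber_eq (n : nat) (L : zmodClosed 'rV[int]_n) (u v : 'X_{1..n}) :
  mnm_row v - mnm_row u \in L -> fiber L v = fiber L u.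
Proof.
move=> Lvu; apply/seteqP; split=> x; rewrite /fiber /= => Lx.
  by rewrite -[mnm_row x](subrK (mnm_row v)) -addrA rpredD.
by rewrite -[mnm_row x](subrK (mnm_row u)) -addrA rpredD // -opprB rpredN.
Qed.

Lemma mnm_shift_fiber (n : nat) (L : zmodClosed 'rV[int]_n)
    (a u v : 'X_{1..n}) :
  mnm_shift a (fiber L u) `<=` fiber L v <->
  mnm_row a + mnm_row u - mnm_row v \in L.
Proof.
split=> [sub|La _ [x Lx <-]].
  rewrite -mnm_rowD; apply: sub; exists u => //.
  by rewrite /fiber /= subrr rpred0.
have -> : fiber L v = fiber L (a + u)%MM.
  by apply/esym/fiber_eq; rewrite mnm_rowD.
by rewrite /fiber /= !mnm_rowD opprD addrACA subrr add0r.
Qed.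

(** Left to right, the shift [a] serves as [y]: its support lies in [sigma L]
    because [a + b] is in L^+. *)
Lemma fiber_equivP (n : nat) (L : zmodClosed 'rV[int]_n) (u v : 'X_{1..n}) :
  fiber_equiv (fiber L u) (fiber L v) <->
  exists2 y, supported (sigma L) y & mnm_row v - (mnm_row u + y) \in L.
Proof.
split=> [[a [b [/mnm_shift_fiber La /mnm_shift_fiber Lb]]]|[y yS Ly]].
  exists (mnm_row a); last by rewrite -opprB rpredN [mnm_row u + _]addrC.
  have Lab : lattice_pos L (mnm_row (a + b)%MM).
    split; last by move=> i; rewrite mxE.
    suff -> : mnm_row (a + b)%MM = (mnm_row a + mnm_row u - mnm_row v)
                                   + (mnm_row b + mnm_row v - mnm_row u).
      exact: rpredD.
    by rewrite mnm_rowD; apply/rowP=> i; rewrite !mxE; ring.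
  move=> i /(lattice_pos_supported Lab); rewrite !mxE mnmDE.
  by case=> /eqP; rewrite addn_eq0 => /andP[/eqP->].
(* Translates of [y] and [- y] by L^+ provide the two shifts. *)
have [w [Lw _] yw_ge0] := lattice_pos_translate yS.
have NyS : supported (sigma L) (- y) by move=> i iS; rewrite mxE yS ?oppr0.
have [w' [Lw' _] yw'_ge0] := lattice_pos_translate NyS.
have [|a aE] := @mnm_row_onto _ (y + w); first by move=> i; rewrite mxE.
have [|b bE] := @mnm_row_onto _ (- y + w').
  by move=> i; rewrite mxE.
exists a, b; split; apply/mnm_shift_fiber.
  have -> : mnm_row a + mnm_row u - mnm_row v
            = w - (mnm_row v - (mnm_row u + y)).
    by rewrite aE; apply/rowP=> i; rewrite !mxE; ring.
  exact: rpredB.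
have -> : mnm_row b + mnm_row v - mnm_row u
          = w' + (mnm_row v - (mnm_row u + y)).
  by rewrite bE; apply/rowP=> i; rewrite !mxE; ring.
exact: rpredD.
Qed.

(** The fiber of [u] moved by [z].  The vector [u + extend z] may have negative
    entries, so this is stated by a congruence rather than as a [fiber]. *)
Definition translate_fiber (n : nat) (L : zmodClosed 'rV[int]_n)
    (u : 'X_{1..n}) (z : 'rV[int]_#|sigma L|) : set 'X_{1..n} :=
  [set v | mnm_row v - (mnm_row u + extend z) \in L].

(** Non-emptiness gives a base point in N^n, which makes the translate an
    actual fiber. *)
Lemma translate_fiber_neq0 (n : nat) (L : zmodClosed 'rV[int]_n)
    (u : 'X_{1..n}) (z : 'rV[int]_#|sigma L|) :
  exists v, translate_fiber u z v.
Proof.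
have [w [Lw _] zw_ge0] := lattice_pos_translate (@supported_extend _ _ z).
have [|v vE] := @mnm_row_onto _ (mnm_row u + (extend z + w)).
  by move=> i; rewrite 3!mxE addr_ge0 //= -mxE.
exists v; rewrite /translate_fiber /= vE.
by rewrite [mnm_row u + _]addrA [X in X - _]addrC addrK.
Qed.

Lemma translate_fiberE (n : nat) (L : zmodClosed 'rV[int]_n)
    (u v : 'X_{1..n}) (z : 'rV[int]_#|sigma L|) :
  translate_fiber u z v -> translate_fiber u z = fiber L v.
Proof.
rewrite /translate_fiber /= => Lv; apply/seteqP; split=> x /= Lx.
  rewrite /fiber /= -[mnm_row x](subrK (mnm_row u + extend z)) -addrA.
  by rewrite rpredD // -opprB rpredN.
by rewrite -[mnm_row x](subrK (mnm_row v)) -addrA rpredD.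
Qed.

Lemma eq_translate_fiber (n : nat) (L : zmodClosed 'rV[int]_n)
    (u : 'X_{1..n}) (z z' : 'rV[int]_#|sigma L|) :
  translate_fiber u z = translate_fiber u z' <->
  z - z' \in lattice_pure_sigma L.
Proof.
rewrite mem_lattice_pure_sigma extendB.
have [v vz] := translate_fiber_neq0 u z.
have diff : extend z - extend z' =
    (mnm_row v - (mnm_row u + extend z')) - (mnm_row v - (mnm_row u + extend z)).
  by apply/rowP=> i; rewrite !mxE; ring.
split=> [eqz|Lz]; first by rewrite diff rpredB //; have := vz; rewrite eqz.
rewrite (translate_fiberE vz); apply/esym/translate_fiberE.
by rewrite diff in Lz; rewrite /translate_fiber /= -(rpredBr _ vz).
Qed.

Lemma fiber_class_translate (n : nat) (L : zmodClosed 'rV[int]_n)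
    (u : 'X_{1..n}) :
  fiber_class L (fiber L u) = range (@translate_fiber n L u).
Proof.
apply/seteqP; split=> [_ [[v ->] /fiber_equivP[y yS Ly]]|_ [z _ <-]].
  exists (restr (sigma L) y) => //; apply: translate_fiberE.
  by rewrite /translate_fiber /= restrK.
have [v vz] := translate_fiber_neq0 u z.
rewrite (translate_fiberE vz); split; first by exists v.
by apply/fiber_equivP; exists (extend z) => //; apply: supported_extend.
Qed.

(** * Counting the class *)

Theorem proposition3p5 (n : nat) (L : zmodClosed 'rV[int]_n)
    (F : set 'X_{1..n}) (nonposL : non_positive L) (fiberF : is_fiber L F) :
  fiber_class L F #= [set: Quotient.quot (lattice_pure_sigma L)].
Proof.
case: fiberF => u ->; rewrite fiber_class_translate.
set Q := Quotient.quot _.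
have -> : range (@translate_fiber n L u) =
          range (fun q : Q => translate_fiber u (repr q)).
  apply/seteqP; split=> [_ [z _ <-]|_ [q _ <-]]; last by exists (repr q).
  exists (\pi_Q z)%qT => //; apply/eq_translate_fiber.
  by rewrite Quotient.idealrBE reprK.
apply: inj_card_eq => q q' _ _ /eq_translate_fiber.
by rewrite Quotient.idealrBE !reprK => /eqP.
Qed.
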